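(* For every monotonically non-decreasing concave function $f:\{0,1,\dots,n\}\to\mathbb{R}_{\ge0}$ with $f(0)=0$ (and $f(1)=1$), the asymptotic approximation ratio of algorithm MatchHalf (MH) for GCBP with cost function $f$ is at most $1.5$.
   Context: GCBP: items $I=\{1,\dots,n\}$ with sizes $1\ge s_1\ge\dots\ge s_n\ge0$ and a non-decreasing concave cost function $f$ with $f(0)=0$, $f(1)=1$; a solution partitions $I$ into bins $S_1,\dots,S_m$ with $\sum_{j\in S_i}s_j\le1$, with cost $\sum_i f(|S_i|)$, to be minimized. The asymptotic approximation ratio of an algorithm $\mathcal A$ is the infimum $R\ge1$ such that there is a constant $c$ independent of the input with $\mathcal A(I)\le R\cdot\mathrm{OPT}(I)+c$ for all inputs $I$ (costs measured with $f$). Next Fit Increasing (NFI): sort items in non-decreasing order of size (i.e., by decreasing index); keep a single open bin; put the next item into the open bin if it fits (total size stays $\le1$), otherwise open a new bin for it (the previous bin is never used again). Weight function $w:[0,1]\to\mathbb{R}$: let $\pi_1=2$, $\pi_{i+1}=\pi_i(\pi_i-1)+1$. For $p\in(\frac1{k+1},\frac1k]$ ($k\ge1$ integer), $w(p)=\frac1k$ if $k=\pi_i-1$ for some $i\ge1$, and $w(p)=\frac{k+1}{k}p$ otherwise; $w(0)=0$. Algorithm MH (does not use $f$): (1) let $t$ be the number of items of size in $(\frac12,1]$ (large items); (2) let $M_0=\{\lceil\frac{t+1}2\rceil,\dots,t\}$ (the $\lceil t/2\rceil$ smallest large items) and $S=\{t+1,\dots,n\}$ (small items); (3) consider the bipartite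 graph between $M_0$ and $S$ with an edge $(a,b)$ iff $s_a+s_b\le1$, of cost $w(s_b)$; (4) compute a maximum cost matching by the greedy process: put $S$ in a queue with item $t+1$ first (in order $t+1,t+2,\dots$) and $M_0$ in a queue with item $t$ first (in order $t,t-1,\dots$); repeatedly, with $j$ the head of the first queue and $i$ the head of the second, if $s_i+s_j\le1$ match them and remove both, otherwise remove $j$; stop when a queue is empty; (5) pack every matched pair together in its own bin and remove these items; (6) pack the remaining items by NFI. *)

(* Defs.v *)
(* Bin packing with general cost structures (GCBP) and the algorithm MatchHalf,
   on MathComp / MathComp-Analysis. *)
From HB Require Import structures.
From mathcomp Require Import all_boot all_order all_algebra.
From mathcomp Require Import classical_sets reals ereal.

Set Implicit Arguments.
Unset Strict Implicit.
Unset Printing Implicit Defensive.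

Import Order.TTheory GRing.Theory Num.Theory.

Local Open Scope ring_scope.

(* Items are the ordinals of 'I_n: the item numbered k in 1..n is the ordinal
   of value k - 1. *)
Definition sorted_sizes (R : realType) (n : nat) (s : 'I_n -> R) : Prop :=
  (forall i, 0 <= s i <= 1) /\ (forall i j : 'I_n, (i <= j)%N -> s j <= s i).

(* A function on {0,...,n} is represented by f : nat -> R; values beyond n are
   unconstrained, and no bin of an n-item instance ever uses them. *)
Definition cost_function (R : realType) (n : nat) (f : nat -> R) : Prop :=
  [/\ f 0%N = 0,
      ((0 < n)%N -> f 1%N = 1),
      (forall k, (k <= n)%N -> 0 <= f k),
      (forall k l, (k <= l <= n)%N -> f k <= f l)
    & (forall k, (k.+2 <= n)%N -> f k.+2 - f k.+1 <= f k.+1 - f k)].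

Section Packings.
Variables (R : realType) (n : nat).
Implicit Types (s : 'I_n -> R) (f : nat -> R) (P : {set {set 'I_n}}).

(* partition excludes empty bins, which cost f 0 = 0 anyway. *)
Definition packing s P : bool :=
  finset.partition P [set: 'I_n] && [forall B in P, \sum_(i in B) s i <= 1].

Definition cost f P : R := \sum_(B in P) f #|B|.

(* The start value of the minimum is the cost of the all-singletons packing,
   itself feasible because all sizes are at most 1. *)
Definition OPT f s : R :=
  \big[Num.min/cost f [set [set i] | i : 'I_n]]_(P | packing s P) cost f P.

Fixpoint next_fit_open s (B : {set 'I_n}) (l : seq 'I_n) : seq {set 'I_n} :=
  if l is j :: l' then
    if \sum_(i in B) s i + s j <= 1 then next_fit_open s (j |: B) l'
    else B :: next_fit_open s [set j] l'
  else [:: B].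

Definition next_fit s (l : seq 'I_n) : seq {set 'I_n} :=
  if l is j :: l' then next_fit_open s [set j] l' else [::].

(* The items of A are packed by decreasing index, i.e. by non-decreasing size. *)
Definition NFI s (A : {set 'I_n}) : seq {set 'I_n} := next_fit s (rev (enum A)).

Definition num_large s : nat := #|[set i | 2^-1 < s i]|.

(* With k = i + 1: ceil((t+1)/2) <= k <= t. *)
Definition half_large s : {set 'I_n} :=
  [set i : 'I_n | (uphalf (num_large s).+1 <= i.+1 <= num_large s)%N].

Definition small s : {set 'I_n} := [set i : 'I_n | (num_large s < i.+1)%N].

Fixpoint greedy_matching s (qS qM : seq 'I_n) : seq ('I_n * 'I_n) :=
  match qS, qM with
  | j :: qS', i :: qM' =>
      if s i + s j <= 1 then (i, j) :: greedy_matching s qS' qM'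
      else greedy_matching s qS' qM
  | _, _ => [::]
  end.

(* The edge costs of the bipartite graph do not appear: the greedy process,
   which compares sizes only, determines the matching. *)
Definition MH_matching s : seq ('I_n * 'I_n) :=
  greedy_matching s (enum (small s)) (rev (enum (half_large s))).

Definition MH_pairs s : seq {set 'I_n} :=
  [seq [set e.1; e.2] | e <- MH_matching s].

Definition MH s : {set {set 'I_n}} :=
  [set B in MH_pairs s ++ NFI s (~: \bigcup_(B <- MH_pairs s) B)].

End Packings.

(* A cost function for GCBP provides, for every number n of items, a function
   f n on {0,...,n}; the additive constant may depend on f but not on the
   instance.  The infimum is taken in \bar R so that it is +oo when no ratio is
   achieved. *)
Definition asymptotic_ratio (R : realType)
    (A : forall n, ('I_n -> R) -> {set {set 'I_n}}) (f : nat -> nat -> R) :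
    \bar R :=
  ereal_inf (EFin @` [set r : R | 1 <= r /\
    exists c : R, forall (n : nat) (s : 'I_n -> R), sorted_sizes s ->
      cost (f n) (A n s) <= r * OPT (f n) s + c])%classic.

(* Main.v *)
(* A concave cost function is a nonnegative combination, of total weight 1, of
   the capped costs k |-> min k q, so it suffices to compare MH with an arbitrary
   packing P for each capped cost, with an additive constant that depends neither
   on n nor on q.  Let t be the number of large items.

   For q = 1, give a small item of size p the weight min (p / (1 - p)) (1 / 2).
   An NFI bin with smallest item p followed by an item x has weight at least
   (1 - x) / (1 - p), and these losses telescope, so NFI uses at most O(1)
   bins more than the total weight.  A bin of P without a large item has weight
   at most 3 / 2; with a large item and with b as largest small item, its small
   items weigh at most 1 / 2 + w(b) / 2.  The greedy matching collects at least
   half of the sum of the w(b), which pays for the second term.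

   For q >= 2, MH creates at most (t + 1) / 2 pairs of cost 2, so it suffices to
   show that NFI on the unmatched small items V costs at most
   3 / 2 * sum_B min #|V :&: B| (q - [B has a large item]) + O(1).  With the
   weight min 1 ((q + 1) p), NFI costs at most the total weight, except for one
   bin Bs at the transition between items below and above 1 / (q + 1); the excess
   min #|Bs| q - W Bs may be of order q.  It is absorbed by the slack of P: a bin
   with at least q items has slack about q / 2, and if there is only one such bin,
   then it has at most as many items of V as the first NFI bin, so that the items
   of V outside it provide the rest. *)
Require Import Defs.
From mathcomp Require Import all_boot all_order all_algebra.
From mathcomp Require Import classical_sets reals ereal.
(* fintype and finset come last because classical_sets shadows their lemmas. *)
From mathcomp Require Import fintype finset zify ring lra.

Set Implicit Arguments.
Unset Strict Implicit.
Unset Printing Implicit Defensive.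

Import Order.TTheory GRing.Theory Num.Theory.

Local Open Scope ring_scope.

(** * Next fit with capped costs *)

Section NextFit.
Variables (R : realType) (n : nat) (s : 'I_n -> R).
Implicit Types (B X : {set 'I_n}) (l : seq 'I_n).

Lemma bin_cost_setU1 q j B : (minn #|j |: B| q <= (minn #|B| q).+1)%N.
Proof. by rewrite cardsU1; case: (j \notin B) => /=; lia. Qed.

(** Each later item joins the last bin or opens a new one, and so raises the capped cost by at most
    1. *)
Lemma next_fit_open_cost_cat q B l1 l2 :
  (\sum_(C <- next_fit_open s B (l1 ++ l2)) minn #|C| q <=
   \sum_(C <- next_fit_open s B l1) minn #|C| q + size l2)%N.
Proof.
elim: l1 B => [|j l1 IH] B /=; last first.
  by case: ifP => _; rewrite ?big_cons -?addnA ?leq_add2l; exact: IH.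
rewrite big_seq1; elim: l2 B => [|j l IH] B /=; first by rewrite big_seq1 addn0.
case: ifP => _.
  by apply: leq_trans (IH _) _; rewrite addnS -addSn leq_add2r bin_cost_setU1.
by rewrite big_cons leq_add2l; apply: leq_trans (IH _) _; rewrite cards1; lia.
Qed.

Lemma next_fit_cost_cat q l1 l2 :
  (\sum_(C <- next_fit s (l1 ++ l2)) minn #|C| q <=
   \sum_(C <- next_fit s l1) minn #|C| q + size l2)%N.
Proof.
case: l1 => [|j l1] /=; last exact: next_fit_open_cost_cat.
rewrite big_nil; case: l2 => [|j l2] /=; first by rewrite big_nil.
apply: leq_trans (next_fit_open_cost_cat q [set j] [::] l2) _.
by rewrite big_seq1 cards1; lia.
Qed.

Lemma sum_setID (F : 'I_n -> R) B X :
  \sum_(i in X) F i = \sum_(i in X :&: B) F i + \sum_(i in X :\: B) F i.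
Proof. exact: big_setID. Qed.

(** An exchange argument: if [X] had more items than [B], then [X :\: B] would have more items than
    [B :\: X], all of size at least [c], and [X] would be at least as large as [B] plus [c]. *)
Lemma card_fit_le B X c :
  (forall i, i \in B -> s i <= c) -> (forall i, i \in X :\: B -> c <= s i) ->
  0 <= c -> 1 < \sum_(i in B) s i + c -> \sum_(i in X) s i <= 1 ->
  (#|X| <= #|B|)%N.
Proof.
move=> hB hX c0 hs; rewrite leqNgt => hsX; apply/negP => hc.
have h1 : \sum_(i in B :\: X) s i <= c *+ #|B :\: X|.
  rewrite -sumr_const; apply: ler_sum => i; rewrite inE => /andP[_]; exact: hB.
have h2 : c *+ #|X :\: B| <= \sum_(i in X :\: B) s i.
  by rewrite -sumr_const; apply: ler_sum => i; exact: hX.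
have h3 : c *+ #|B :\: X| + c <= c *+ #|X :\: B|.
  rewrite -mulrSr; apply: ler_wpMn2l => //.
  by have := cardsID B X; have := cardsID X B; rewrite setIC; lia.
by move: hs hsX; rewrite (sum_setID s X B) (sum_setID s B X) (setIC X); lra.
Qed.

(** With the factor [q + 1], a bin weighs at least [q] as soon as its items and the item that closes
    it are at most [1 / (q + 1)]. *)
Definition cap_weight q (p : R) : R := Num.min 1 (q.+1%:R * p).

Lemma cap_weight_le1 q p : cap_weight q p <= 1.
Proof. by rewrite ge_min lexx. Qed.

Lemma cap_weight_le q p : cap_weight q p <= q.+1%:R * p.
Proof. by rewrite ge_min lexx orbT. Qed.

(** [B1] is the final content of the open bin; [Bs] is the first bin closed by an item above
    [1 / (q + 1)], or the last bin if there is none. Bins before [Bs] weigh at least [q] and items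
    after it weigh 1 each, so only [Bs] may cost more than its weight. *)
Lemma next_fit_open_cap_weight q B l :
  (forall i, 0 <= s i) -> uniq l -> sorted (relpre s <=%R) l ->
  (forall i j, i \in B -> j \in l -> s i <= s j) ->
  (forall i, i \in l -> i \notin B) ->
  exists B1 Bs : {set 'I_n}, let V := B :|: [set i in l] in
  [/\ B1 = Bs \/ [disjoint B1 & Bs], B1 \subset V, Bs \subset V,
    forall X, X \subset V -> \sum_(i in X) s i <= 1 -> (#|X| <= #|B1|)%N &
    (\sum_(C <- next_fit_open s B l) minn #|C| q)%:R <=
      \sum_(i in V :\: Bs) cap_weight q (s i) + (minn #|Bs| q)%:R].
Proof.
move=> s0; elim: l B => [|j l IH] B /=.
  move=> _ _ _ _; exists B, B; rewrite set_nil setU0 setDv big_set0 add0r big_seq1.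
  by split => //; [left | move=> X /subset_leq_card].
move=> /andP[jl ul] hsort hB hd.
have tr : transitive (relpre s <=%R) by move=> x y z; exact: le_trans.
have /allP hj := order_path_min tr hsort.
have sl := path_sorted hsort.
have -> : B :|: [set i in j :: l] = (j |: B) :|: [set i in l].
  by apply/setP => i; rewrite !inE; case: (i == j); case: (i \in B).
case: ifP => [_|/negbT].
  apply: IH => //.
    move=> i k; rewrite !inE => /predU1P[->|iB] kl; first exact: hj.
    by apply: hB => //; rewrite inE kl orbT.
  move=> i il; rewrite !inE negb_or hd ?inE ?il ?orbT // andbT.
  by apply: contraNneq jl => <-.
rewrite -ltNge => hover.
set V := _ :|: _.
have BV : B \subset V by apply/subsetP => i iB; rewrite !inE iB orbT.
have jB : j \notin B by apply: hd; rewrite inE eqxx.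
have VB : V :\: B = [set j] :|: [set i in l].
  apply/setP => i; rewrite !inE; case: (boolP (i \in B)) => //=.
    case: eqP => [->|_] iB; first by rewrite (negbTE jB) in iB.
    by apply/esym/negbTE/negP => /(mem_behead (s := j :: l))/hd; rewrite iB.
  by rewrite orbF.
have hfit X : X \subset V -> \sum_(i in X) s i <= 1 -> (#|X| <= #|B|)%N.
  move=> XV; apply: (@card_fit_le _ _ (s j)) => //.
    by move=> i iB; apply: hB => //; rewrite inE eqxx.
  move=> i /(subsetP (setSD _ XV)); rewrite VB !inE => /predU1P[->//|]; exact: hj.
have q1 : 0 < q.+1%:R :> R by rewrite ltr0n.
have [tiny|big] := leP (q.+1%:R * s j) 1.
  have [] := IH [set j] => //.
  - by move=> i k; rewrite inE => /eqP->; exact: hj.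
  - by move=> i il; rewrite inE; apply: contraNneq jl => <-.
  rewrite -VB => B1' [Bs [_ _ BsV _ hcost]].
  exists B, Bs; split => //.
  - by right; rewrite disjoint_sym disjoints_subset (subset_trans BsV) ?subsetDr.
  - by rewrite (subset_trans BsV) ?subsetDl.
  rewrite big_cons natrD.
  rewrite (sum_setID _ B (V :\: Bs)).
  have -> : (V :\: Bs) :&: B = B.
    apply/setP => i; rewrite !inE; case: (boolP (i \in B)) => iB; rewrite ?andbF //=.
    by rewrite orbT !andbT; apply/negP => /(subsetP BsV); rewrite inE iB.
  have -> : (V :\: Bs) :\: B = (V :\: B) :\: Bs by rewrite setDDl setUC -setDDl.
  suff : (minn #|B| q)%:R <= \sum_(i in B) cap_weight q (s i) by lra.
  apply: (@le_trans _ _ q%:R); first by rewrite ler_nat geq_minr.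
  have -> : \sum_(i in B) cap_weight q (s i) = \sum_(i in B) q.+1%:R * s i.
    apply: eq_bigr => i iB; rewrite /cap_weight; apply/min_idPr.
    apply: le_trans tiny; rewrite ler_pM2l // hB //; exact: mem_head.
  rewrite -mulr_sumr.
  have : q.+1%:R * (\sum_(i in B) s i + s j) > q.+1%:R * 1 by rewrite ltr_pM2l.
  by rewrite mulrDr -natr1; nra.
(* The closing item [j] and all later ones have weight 1, and the remaining bins cost at most their
   number of items. *)
exists B, B; split => //; first by left.
rewrite big_cons VB natrD addrC lerD2r.
apply: (@le_trans _ _ ((size l).+1%:R)).
  rewrite ler_nat; apply: leq_trans (next_fit_open_cost_cat q [set j] [::] l) _.
  by rewrite big_seq1 cards1; lia.
have -> : (size l).+1 = #|[set j] :|: [set i in l]|.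
  by rewrite cardsU1 inE jl cardsE (card_uniqP ul).
rewrite -sumr_const; apply: ler_sum => i hi.
rewrite le_min lexx /=; apply/ltW; apply: (lt_le_trans big).
rewrite ler_pM2l //; move: hi; rewrite !inE => /predU1P[->//|]; exact: hj.
Qed.

End NextFit.

(** * NFI against an arbitrary packing, for capped costs *)

Section NFIBound.
Variables (R : realType) (n : nat) (s : 'I_n -> R).
Implicit Types (B X V : {set 'I_n}) (P : {set {set 'I_n}}) (l : seq 'I_n).

Lemma sorted_enum_ord V : sorted (relpre val ltn) (enum V).
Proof.
rewrite /enum_mem; apply: sorted_filter => [x y z|]; first exact: ltn_trans.
by rewrite -sorted_map -enumT val_enum_ord iota_ltn_sorted.
Qed.

Lemma sorted_rev_enum V :
  sorted_sizes s -> sorted (relpre s <=%R) (rev (enum V)).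
Proof.
move=> [_ mono]; rewrite rev_sorted.
by apply: sub_sorted (sorted_enum_ord V) => i j /ltnW; exact: mono.
Qed.

Lemma sum_partition P V (F : 'I_n -> R) : finset.partition P [set: 'I_n] ->
  \sum_(i in V) F i = \sum_(B in P) \sum_(i in V :&: B) F i.
Proof.
move=> hP; transitivity (\sum_(i in [set: 'I_n] | i \in V) F i).
  by apply: eq_bigl => i; rewrite inE.
rewrite (set_partition_big_cond _ hP); apply: eq_bigr => B _.
by apply: eq_bigl => i; rewrite inE andbC.
Qed.

Lemma sum_const_card V (c : R) : \sum_(i in V) c = c * #|V|%:R.
Proof. by rewrite sumr_const mulr_natr. Qed.

Lemma sum_subset_le (F : 'I_n -> R) X V : (forall i, 0 <= F i) ->
  X \subset V -> \sum_(i in X) F i <= \sum_(i in V) F i.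
Proof.
move=> F0 XV; rewrite (sum_setID F X V) (setIidPr XV) lerDl.
exact: sumr_ge0.
Qed.

Lemma NFI_cap_weight q V : sorted_sizes s ->
  exists B1 Bs : {set 'I_n},
  [/\ B1 = Bs \/ [disjoint B1 & Bs], B1 \subset V, Bs \subset V,
    forall X, X \subset V -> \sum_(i in X) s i <= 1 -> (#|X| <= #|B1|)%N &
    (\sum_(C <- NFI s V) minn #|C| q)%:R <=
      \sum_(i in V :\: Bs) cap_weight q (s i) + (minn #|Bs| q)%:R].
Proof.
move=> hs; have := sorted_rev_enum V hs; rewrite /NFI.
have hV : V = [set i in rev (enum V)].
  by apply/setP => i; rewrite inE mem_rev mem_enum.
have : uniq (rev (enum V)) by rewrite rev_uniq enum_uniq.
move: (rev _) hV => l -> {V}; case: l => [|j l] /=.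
  exists set0, set0; rewrite set_nil; split; rewrite ?sub0set //; first by left.
    by move=> X; rewrite subset0 => /eqP->; rewrite cards0.
  by rewrite big_nil set0D big_set0 add0r ler0n.
have tr : transitive (relpre s <=%R) by move=> x y z; exact: le_trans.
move=> /andP[jl ul] hsort; have /allP hj := order_path_min tr hsort.
have -> : [set i in j :: l] = [set j] :|: [set i in l].
  by apply/setP => i; rewrite !inE.
apply: next_fit_open_cap_weight => //.
- by move=> i; have [/(_ i)/andP[]] := hs.
- exact: path_sorted hsort.
- by move=> i k; rewrite inE => /eqP->; exact: hj.
- by move=> i il; rewrite inE; apply: contraNneq jl => <-.
Qed.

(** [ell] marks the bins of [P] with a large item. The slacks [sg] of the bins of [P] must cover the
    excess of the cost of [Bs] over its weight, up to 2. A bin that is not [over] has slack at least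
    [1 / 2] per item of [V]. *)
Lemma NFI_cost_le q P V (ell : {set 'I_n} -> bool) :
  sorted_sizes s -> (1 < q)%N -> finset.partition P [set: 'I_n] ->
  (forall B, B \in P -> \sum_(i in V :&: B) s i <= 1 - (ell B)%:R / 2) ->
  (\sum_(C <- NFI s V) minn #|C| q)%:R <=
    3 / 2 * (\sum_(B in P) minn #|V :&: B| (q - ell B))%:R + 2 :> R.
Proof.
move=> hs q2 hP hfit.
have q2R : 2 <= q%:R :> R by rewrite ler_nat.
have [B1 [Bs [hB1 B1V BsV hmax hcost]]] := NFI_cap_weight q V hs.
pose w i := cap_weight q (s i).
have w1 i : w i <= 1 by exact: cap_weight_le1.
have w0 i : 0 <= w i.
  by rewrite le_min ler01 mulr_ge0 ?ler0n //; have [/(_ i)/andP[]] := hs.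
pose val B := minn #|V :&: B| (q - ell B).
pose W X := \sum_(i in X) w i.
pose G X := \sum_(i in X) (3 / 2 - w i).
have GE X : G X = 3 / 2 * #|X|%:R - W X.
  by rewrite /G sumrB sum_const_card.
have G0 X : 0 <= G X by apply: sumr_ge0 => i _; have := w1 i; lra.
have W1 X : W X <= #|X|%:R.
  by rewrite -[leRHS]mul1r -sum_const_card; apply: ler_sum => i _; exact: w1.
pose sg B := 3 / 2 * (val B)%:R - W (V :&: B).
have sgE : \sum_(B in P) sg B = 3 / 2 * (\sum_(B in P) val B)%:R - W V.
  by rewrite sumrB -mulr_sumr natr_sum /W (sum_partition V _ hP).
pose over B := (q - ell B < #|V :&: B|)%N.
have sgN B : ~~ over B -> sg B = G (V :&: B).
  by rewrite -leqNgt => h; rewrite /sg /val GE (minn_idPl h).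
(* The bound on the total size gives slack [q / 2 - 1] without a large item and [q - 2] with one;
   the latter is no less because [q >= 2]. *)
have sgO B : B \in P -> over B -> q%:R / 2 - 1 <= sg B.
  move=> BP h; rewrite /sg /val (minn_idPr (ltnW h)) natrB; last first.
    by case: (ell B) => //; exact: ltnW.
  have : W (V :&: B) <= q.+1%:R * (1 - (ell B)%:R / 2).
    apply: le_trans (ler_wpM2l (ler0n _ _) (hfit _ BP)); rewrite mulr_sumr.
    by apply: ler_sum => i _; exact: cap_weight_le.
  by rewrite -natr1; case: (ell B) => /=; lra.
have sg0 B : B \in P -> 0 <= sg B.
  by move=> BP; have [/(sgO _ BP)|/sgN->] := boolP (over B); [lra | exact: G0].
suff : (minn #|Bs| q)%:R - W Bs - 2 <= \sum_(B in P) sg B.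
  move: hcost; rewrite -/(W _) sgE /W (sum_setID w Bs V) (setIidPr BsV).
  rewrite /w; lra.
have W0 : 0 <= W Bs by apply: sumr_ge0.
have mq : (minn #|Bs| q)%:R <= q%:R :> R by rewrite ler_nat geq_minr.
have mB : (minn #|Bs| q)%:R <= #|Bs|%:R :> R by rewrite ler_nat geq_minl.
have GV : \sum_(B in P) G (V :&: B) = G V by rewrite -(sum_partition V _ hP).
(* With no bin [over], the slack is [G V], of which the items of [Bs] alone suffice. Two such bins
   have slack [q - 2] together. The case of a single such bin [O] remains. *)
have [hO|[O]] := set_0Vmem [set B in P | over B].
  have -> : \sum_(B in P) sg B = G V.
    rewrite -GV; apply: eq_bigr => B BP; apply: sgN; apply/negP => oB.
    suff : B \in set0 by rewrite inE.
    by rewrite -hO inE BP.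
  have := G0 (V :\: Bs); move: (sum_setID (fun i => 3 / 2 - w i) Bs V).
  rewrite -!/(G _) (setIidPr BsV) => ->; rewrite (GE Bs).
  by have := ler0n R #|Bs|; lra.
rewrite inE => /andP[OP oO].
have [O' /and3P[O'P nO oO']|hO] := pickP [pred B | [&& B \in P, B != O & over B]].
  rewrite (bigD1 O) //= (bigD1 O') /=; last by rewrite O'P.
  have := sgO _ OP oO; have := sgO _ O'P oO'.
  have : 0 <= \sum_(i in P | (i != O) && (i != O')) sg i.
    by apply: sumr_ge0 => B /andP[BP _]; exact: sg0.
  have -> : \sum_(i in P | (i != O) && (i != O')) sg i =
      \sum_(i | (i \in P) && (i != O) && (i != O')) sg i.
    by apply: eq_bigl => B; rewrite andbA.
  lra.
have sgP : \sum_(B in P) sg B = sg O + G (V :\: O).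
  rewrite (bigD1 O) //=; congr (_ + _).
  have := GV; rewrite (bigD1 O) //= /G (sum_setID _ O V) => /addrI <-.
  apply: eq_bigr => B /andP[BP nB]; apply: sgN; move: (hO B) => /=.
  by rewrite BP nB /= => ->.
rewrite sgP GE.
have hX : (#|V :&: O| <= #|B1|)%N.
  apply: hmax; first exact: subsetIl.
  by apply: le_trans (hfit _ OP) _; case: (ell O) => /=; lra.
have hcV := cardsID O V.
(* If [B1 = Bs], the weights inside [Bs] cancel, and the items of [V :&: O] outside [Bs] are no more
   than those of [Bs :\: O], whose terms [3 / 2] in [G (V :\: O)] pay for them. If [B1] and [Bs] are
   disjoint, then [Bs] has at most as many items as [V :\: O], and the slack is at least
   [(q + #|Bs|) / 2 - 1]. *)
case: hB1 => [hB|hB].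
  subst B1; rewrite /sg /val (minn_idPr (ltnW oO)) natrB; last first.
    by case: (ell O) => //; exact: ltnW.
  have hl : (ell O)%:R <= 1 :> R by case: (ell O).
  have -> : W (V :\: O) = W (Bs :\: O) + W ((V :\: O) :\: Bs).
    by rewrite /W (sum_setID w Bs (V :\: O)) setIDAC (setIidPr BsV).
  have -> : W (V :&: O) = W (Bs :&: O) + W ((V :&: O) :\: Bs).
    by rewrite /W (sum_setID w Bs (V :&: O)) setIAC (setIidPr BsV).
  have -> : W Bs = W (Bs :&: O) + W (Bs :\: O) by rewrite /W (sum_setID w O Bs).
  have c1 := cardsID Bs (V :&: O); have c2 := cardsID O Bs.
  have c3 := cardsID Bs (V :\: O).
  have h1 := W1 ((V :\: O) :\: Bs); have h2 := W1 ((V :&: O) :\: Bs).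
  have e1 : (V :&: O) :&: Bs = Bs :&: O by rewrite setIAC (setIidPr BsV).
  have e2 : (V :\: O) :&: Bs = Bs :\: O by rewrite setIDAC (setIidPr BsV).
  rewrite e1 in c1; rewrite e2 in c3.
  have h3 : #|(V :&: O) :\: Bs|%:R <= #|Bs :\: O|%:R :> R.
    by rewrite ler_nat -(leq_add2l #|Bs :&: O|) c1 c2.
  rewrite -c3 natrD; have := ler0n R #|(V :\: O) :\: Bs|.
  have := ler0n R #|Bs :\: O|; lra.
have hc : (#|Bs| <= #|V :\: O|)%N.
  have : (#|B1 :|: Bs| <= #|V|)%N by apply: subset_leq_card; rewrite subUset B1V.
  rewrite cardsU; move: hB; rewrite -setI_eq0 => /eqP->; rewrite cards0 subn0 => h.
  by rewrite -(leq_add2l #|B1|) (leq_trans h) // -hcV leq_add2r.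
have := sgO _ OP oO; have := W1 (V :\: O).
by move: hc; rewrite -(ler_nat R); lra.
Qed.

End NFIBound.

(** * Next fit with unit bin costs *)

Section HalfWeight.
Variables (R : realType) (n : nat) (s : 'I_n -> R).
Implicit Types (B X V : {set 'I_n}) (l : seq 'I_n) (p x : R).

(** The two terms agree at [p = 1 / 3]. Since [1 / 0] is [0], the weight drops to 0 at [p = 1], and
    monotonicity holds only below 1. *)
Definition half_weight p : R := Num.min (p / (1 - p)) (1 / 2).

Lemma half_weight_ge0 p : 0 <= p <= 1 -> 0 <= half_weight p.
Proof.
by move=> hp; rewrite le_min; apply/andP; split; [rewrite divr_ge0; lra | lra].
Qed.

Lemma half_weight_le_half p : half_weight p <= 1 / 2.
Proof. by rewrite ge_min lexx orbT. Qed.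

Lemma half_weight_third p : p <= 1 / 3 -> half_weight p = p / (1 - p).
Proof. by move=> hp; apply/min_idPl; rewrite ler_pdivrMr; lra. Qed.

Lemma half_weight_big p : 1 / 3 <= p -> p < 1 -> half_weight p = 1 / 2.
Proof. by move=> hp p1; apply/min_idPr; rewrite ler_pdivlMr; lra. Qed.

Lemma half_weight_le p : 0 <= p < 1 -> half_weight p <= 3 / 2 * p.
Proof.
move=> hp; have [h|h] := leP p (1 / 3).
  by rewrite half_weight_third // ler_pdivrMr; nra.
by rewrite half_weight_big; lra.
Qed.

Lemma half_weight_mono p x : 0 <= p -> p <= x -> x < 1 ->
  half_weight p <= half_weight x.
Proof.
move=> p0 px x1; have [hx|hx] := leP x (1 / 3); last first.
  by rewrite (half_weight_big (ltW hx)) // half_weight_le_half.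
rewrite !half_weight_third; try lra.
by rewrite ler_pdivrMr ?subr_gt0 1?mulrAC ?ler_pdivlMr; nra.
Qed.

(** While [p <= 1 / 3], a bin closed by [x] lacks at most [3 / 2 * (x - p)] of weight, and these
    terms telescope. The constant 2 pays for the bin at which the sizes pass [1 / 3] and for the
    last bin. Beyond [1 / 3], a closed bin lacks nothing. *)
Lemma next_fit_open_half_weight B l p :
  (forall i, i \in B :|: [set i in l] -> 0 <= s i <= 1 / 2) ->
  uniq l -> sorted (relpre s <=%R) l ->
  (forall i j, i \in B -> j \in l -> s i <= s j) ->
  (forall i, i \in l -> i \notin B) ->
  0 <= p -> B != set0 -> (forall i, i \in B -> p <= s i) ->
  (size (next_fit_open s B l))%:R <=
    \sum_(i in B :|: [set i in l]) half_weight (s i) +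
    (if p <= 1 / 3 then 2 + 3 / 2 * (1 / 2 - p) else 1).
Proof.
elim: l B p => [|j l IH] B p hs; rewrite [next_fit_open _ _ _]/=.
  move=> _ _ _ _ p0 B0 _; apply: (@le_trans _ _ (0 + 1)); first by rewrite add0r.
  apply: lerD; last by case: ifP; lra.
  by apply: sumr_ge0 => i /hs hi; apply: half_weight_ge0; lra.
move=> /andP[jl ul] hsort hB hd p0 B0 hp.
have tr : transitive (relpre s <=%R) by move=> x y z; exact: le_trans.
have /allP hj := order_path_min tr hsort.
have sl := path_sorted hsort.
have eV : B :|: [set i in j :: l] = (j |: B) :|: [set i in l].
  by apply/setP => i; rewrite !inE; case: (i == j); case: (i \in B).
have jB : j \notin B by apply: hd; rewrite inE eqxx.
have [b bB] := set0Pn _ B0.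
have sj : s b <= s j by apply: hB => //; exact: mem_head.
have pj : p <= s j by apply: le_trans (hp _ bB) sj.
have sj2 : 0 <= s j <= 1 / 2 by apply: hs; rewrite !inE eqxx orbT.
case: ifP => [_|/negbT].
  rewrite eV; apply: IH => //.
  - by rewrite -eV.
  - move=> i k; rewrite !inE => /predU1P[->|iB] kl; first exact: hj.
    by apply: hB => //; rewrite inE kl orbT.
  - move=> i il; rewrite !inE negb_or hd ?inE ?il ?orbT // andbT.
    by apply: contraNneq jl => <-.
  - by apply/set0Pn; exists j; rewrite !inE eqxx.
  - by move=> i; rewrite !inE => /predU1P[->//|]; exact: hp.
rewrite -ltNge => hover.
have {}IH := IH [set j] (s j).
set V := B :|: _.
have VB : V :\: B = [set j] :|: [set i in l].
  apply/setP => i; rewrite !inE; case: (boolP (i \in B)) => //= iB.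
  by apply/esym/negbTE; apply: contraL iB; rewrite -in_cons; exact: hd.
have BV : B \subset V by apply/subsetP => i iB; rewrite !inE iB.
rewrite -VB in IH; rewrite (sum_setID _ B V) (setIidPr BV).
have {}IH : (size (next_fit_open s [set j] l))%:R <=
    \sum_(i in V :\: B) half_weight (s i) +
    (if s j <= 1 / 3 then 2 + 3 / 2 * (1 / 2 - s j) else 1).
  apply: IH => //; try lra.
  - by move=> i; rewrite inE => /andP[_]; exact: hs.
  - by move=> i k; rewrite inE => /eqP->; exact: hj.
  - by move=> i il; rewrite inE; apply: contraNneq jl => <-.
  - by apply/set0Pn; exists j; rewrite inE.
  - by move=> i; rewrite inE => /eqP->.
have hsB i : i \in B -> [/\ 0 <= s i <= 1 / 2, p <= s i & s i <= s j].
  move=> iB; split; [by apply: hs; rewrite inE iB | exact: hp |].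
  by apply: hB => //; exact: mem_head.
have W0 : 0 <= \sum_(i in B) half_weight (s i).
  by apply: sumr_ge0 => i /hsB[? _ _]; apply: half_weight_ge0; lra.
rewrite /= -natr1; have [p3|p3] := leP p (1 / 3).
  move: IH; case: ifP => [j3|_] IH; last by move: IH; lra.
  have : (\sum_(i in B) s i) / (1 - p) <= \sum_(i in B) half_weight (s i).
    rewrite mulr_suml; apply: ler_sum => i /hsB[? ? ?].
    rewrite half_weight_third; last lra.
    by apply: ler_wpM2l; [lra | rewrite lef_pV2 ?posrE; lra].
  (* The sizes in [B] add up to more than [1 - s j], and [1 - p >= 2 / 3]. *)
  suff : 1 - 3 / 2 * (s j - p) <= (\sum_(i in B) s i) / (1 - p) by move: IH; lra.
  by rewrite ler_pdivlMr; [nra | lra].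
move: IH; rewrite ifF; last by lra.
have -> : \sum_(i in B) half_weight (s i) = 1 / 2 * #|B|%:R.
  rewrite -sum_const_card; apply: eq_bigr => i /hsB[? ? ?].
  by rewrite half_weight_big; lra.
(* A single item of size at most [1 / 2] would leave room for [j]; two items weigh [1 / 2] each. *)
suff : 2 <= #|B|%:R :> R by lra.
have : \sum_(i in B) s i <= 1 / 2 * #|B|%:R.
  by rewrite -sum_const_card; apply: ler_sum => i /hsB[? ? ?]; lra.
by case: #|B| => [|[|k]]; rewrite ?ler_nat //; lra.
Qed.

Lemma NFI_card_le V : sorted_sizes s -> (forall i, i \in V -> s i <= 1 / 2) ->
  (size (NFI s V))%:R <= \sum_(i in V) half_weight (s i) + 11 / 4.
Proof.
move=> hs; have := sorted_rev_enum V hs; rewrite /NFI.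
have hV : V = [set i in rev (enum V)].
  by apply/setP => i; rewrite inE mem_rev mem_enum.
have : uniq (rev (enum V)) by rewrite rev_uniq enum_uniq.
move: (rev _) hV => l -> {V}; case: l => [|j l] /=.
  by rewrite set_nil big_set0; lra.
have tr : transitive (relpre s <=%R) by move=> x y z; exact: le_trans.
move=> /andP[jl ul] hsort; have /allP hj := order_path_min tr hsort.
have -> : [set i in j :: l] = [set j] :|: [set i in l].
  by apply/setP => i; rewrite !inE.
move=> hV; have s0 i : 0 <= s i by have [/(_ i)/andP[]] := hs.
(* At [p = 0] the additive term is [2 + 3 / 4 = 11 / 4]. *)
apply: le_trans (next_fit_open_half_weight (p := 0) _ _ _ _ _ _ _ _) _ => //.
- by move=> i /hV; rewrite s0 => ->.
- exact: path_sorted hsort.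
- by move=> i k; rewrite inE => /eqP->; exact: hj.
- by move=> i il; rewrite inE; apply: contraNneq jl => <-.
- by apply/set0Pn; exists j; rewrite inE.
by rewrite ifT; lra.
Qed.

(** If [s b <= 1 / 3], item [i] weighs at most [s i / (1 - s b)], and [(1 / 2) / (1 - s b)] equals
    the bound. Otherwise [b] weighs [1 / 2], and the others, of total size below [1 / 6], weigh at
    most [1 / 4]. *)
Lemma half_weight_bin X b : (forall i, i \in X -> 0 <= s i <= s b) ->
  b \in X -> \sum_(i in X) s i <= 1 / 2 ->
  \sum_(i in X) half_weight (s i) <= 1 / 2 + half_weight (s b) / 2.
Proof.
move=> hX bX hsX.
have sb0 : 0 <= s b by have := hX b bX; lra.
have hD : \sum_(i in X) s i = s b + \sum_(i in X :\ b) s i by rewrite (big_setD1 b).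
have hD0 : 0 <= \sum_(i in X :\ b) s i.
  by apply: sumr_ge0 => i; rewrite inE => /andP[_ /hX]; lra.
have [b3|b3] := leP (s b) (1 / 3).
  have -> : 1 / 2 + half_weight (s b) / 2 = (1 / 2) / (1 - s b).
    by rewrite half_weight_third //; field; lra.
  apply: (@le_trans _ _ ((\sum_(i in X) s i) / (1 - s b))).
    rewrite mulr_suml; apply: ler_sum => i /hX hi.
    rewrite half_weight_third; last lra.
    by apply: ler_wpM2l; [lra | rewrite lef_pV2 ?posrE; lra].
  by apply: ler_wpM2r => //; rewrite invr_ge0; lra.
rewrite (big_setD1 b) //= half_weight_big; try lra.
have : \sum_(i in X :\ b) half_weight (s i) <= 3 / 2 * \sum_(i in X :\ b) s i.
  rewrite mulr_sumr; apply: ler_sum => i; rewrite inE => /andP[_ /hX hi].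
  by apply: half_weight_le; lra.
by lra.
Qed.

End HalfWeight.

(** * The greedy matching *)

Section Matching.
Variables (R : realType) (n : nat) (s : 'I_n -> R).
Implicit Types (X Y : {set 'I_n}) (qS qM : seq 'I_n).

Lemma greedy_fst qS qM :
  [seq e.1 | e <- greedy_matching s qS qM] =
  take (size (greedy_matching s qS qM)) qM.
Proof.
elim: qS qM => [|j qS IH] [|i qM] //=; case: ifP => _ //=.
by rewrite IH.
Qed.

Lemma greedy_snd qS qM :
  subseq [seq e.2 | e <- greedy_matching s qS qM] qS.
Proof.
elim: qS qM => [|j qS IH] [|i qM] //=.
case: ifP => _; rewrite ?map_cons ?eqxx //.
exact: subseq_trans (IH _) (subseq_cons _ _).
Qed.

Lemma greedy_size qS qM : (size (greedy_matching s qS qM) <= size qM)%N.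
Proof.
have := congr1 size (greedy_fst qS qM); rewrite size_map size_take.
by case: ltnP => [/ltnW|_ ->].
Qed.

Lemma greedy_cat q1 q2 qM : greedy_matching s (q1 ++ q2) qM =
  greedy_matching s q1 qM ++
  greedy_matching s q2 (drop (size (greedy_matching s q1 qM)) qM).
Proof.
elim: q1 qM => [|j q1 IH] [|i qM] //=; first by case: (q2).
by case: ifP => _ //=; rewrite IH.
Qed.

(* The last item that the process discards separates [q1] from [q2]. *)
Lemma greedy_blocking qS qM : sorted (fun i j => s j <= s i) qS ->
  size (greedy_matching s qS qM) = size qM \/
  exists q1 q2, [/\ qS = q1 ++ q2,
    size (greedy_matching s qS qM) = (size (greedy_matching s q1 qM) + size q2)%N
    & forall i0 j, j \in q1 ->
        1 < s (nth i0 qM (size (greedy_matching s q1 qM))) + s j].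
Proof.
elim: qS qM => [|j qS IH] qM hsort; first by right; exists [::], [::].
have tr : transitive (fun i j => s j <= s i) by move=> x y z h1 h2; exact: le_trans h2 h1.
have /allP hj := order_path_min tr hsort.
have {}IH := IH _ (path_sorted hsort).
case: qM => [|i qM] /=; first by left.
case: ifP => [hij|/negbT]; last rewrite -ltNge => hij.
  have [e|[q1 [q2 [eS hsz hq]]]] := IH qM; first by left; rewrite /= e.
  (* If [q1] is empty, nothing was discarded. Otherwise [j] is at least as large as the head of [q1]
     and is blocked as well. *)
  right; case: q1 eS hsz hq => [|j1 q1] eS hsz hq.
    by exists [::], (j :: qS); rewrite /= hsz eS.
  exists [:: j, j1 & q1], q2; rewrite /= hij /= -cat_cons -eS; split=> //.
    by rewrite hsz addSn.
  move=> i0 k; rewrite inE => /predU1P[->|]; last exact: hq.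
  apply: lt_le_trans (hq i0 j1 (mem_head _ _)) _; rewrite lerD2l.
  by apply: hj; rewrite eS mem_head.
have [e|[q1 [q2 [eS hsz hq]]]] := IH (i :: qM); first by left; rewrite /= e.
right; have skip q : greedy_matching s (j :: q) (i :: qM) = greedy_matching s q (i :: qM).
  by rewrite /= leNgt hij.
case: q1 eS hsz hq => [|j1 q1] eS hsz hq.
  exists [:: j], qS; rewrite /= leNgt hij /=; split => //.
    by rewrite hsz eS.
  by move=> i0 k; rewrite inE => /eqP->.
exists [:: j, j1 & q1], q2; rewrite skip.
split => //; first by rewrite eS.
move=> i0 k; rewrite inE => /predU1P[->|]; last exact: hq.
apply: lt_le_trans (hq i0 j1 (mem_head _ _)) _; rewrite lerD2l.
by apply: hj; rewrite eS mem_head.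
Qed.

Lemma card_ord_lt k : (k <= n)%N -> #|[set i : 'I_n | (i < k)%N]| = k.
Proof.
move=> kn; have inj : injective (widen_ord kn).
  by move=> i j /(congr1 val) /= h; apply: val_inj.
transitivity #|[set widen_ord kn i | i : 'I_k]|.
  apply: eq_card => i; rewrite inE; apply/idP/imsetP => [ik|[j _ ->]] /=.
    by exists (Ordinal ik) => //; apply: val_inj.
  exact: ltn_ord.
by rewrite card_imset // card_ord.
Qed.

Lemma num_large_le : (num_large s <= n)%N.
Proof. by rewrite -[leqRHS]card_ord max_card. Qed.

Lemma lt_num_large (i : 'I_n) : sorted_sizes s ->
  (i < num_large s)%N = (2^-1 < s i).
Proof.
move=> [_ mono]; rewrite /num_large; set L := [set i | _].
have [iL|iL] := boolP (2^-1 < s i).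
  rewrite -[leqLHS](card_ord_lt (ltn_ord i)); apply: subset_leq_card.
  by apply/subsetP => j; rewrite !inE ltnS => /mono; exact: lt_le_trans.
apply/negbTE; rewrite -leqNgt -[leqRHS](card_ord_lt (ltnW (ltn_ord i))).
apply: subset_leq_card; apply/subsetP => j; rewrite !inE ltnNge => jL.
by apply: contra iL => /mono; exact: lt_le_trans.
Qed.

Lemma card_half_large : #|half_large s| = uphalf (num_large s).
Proof.
set t := num_large s; have tn : (t <= n)%N := num_large_le.
(* The condition [uphalf t.+1 <= i.+1] amounts to [t./2 <= i]. *)
have -> : half_large s = [set i : 'I_n | (i < t)%N] :\: [set i : 'I_n | (i < t./2)%N].
  by apply/setP => i; rewrite !inE -/t; apply/idP/idP; lia.
rewrite cardsD.
have -> : [set i : 'I_n | (i < t)%N] :&: [set i : 'I_n | (i < t./2)%N] =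
    [set i : 'I_n | (i < t./2)%N].
  by apply/setP => i; rewrite !inE; apply/idP/idP; lia.
by rewrite !card_ord_lt; lia.
Qed.

(** This cuts the queue of small items at an index, and in NFI it separates the small items from the
    large ones. *)
Lemma enum_setID_lt X r :
  enum X = enum [set i in X | (i < r)%N] ++ enum [set i in X | (r <= i)%N].
Proof.
apply: (@irr_sorted_eq _ (relpre val ltn)).
- by move=> x y z; exact: ltn_trans.
- by move=> x; exact: ltnn.
- exact: sorted_enum_ord.
- have tr : transitive (relpre (val : 'I_n -> nat) ltn) by move=> x y z; exact: ltn_trans.
  rewrite (sorted_pairwise tr) pairwise_cat -!(sorted_pairwise tr).
  rewrite !sorted_enum_ord !andbT.
  apply/allrelP => i j; rewrite !mem_enum !inE => /andP[_ ir] /andP[_ rj].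
  exact: leq_trans ir rj.
- by move=> i; rewrite mem_cat !mem_enum !inE; case: (i \in X) => //=; case: ltnP.
Qed.

Definition MH_matched : {set 'I_n} := [set j in [seq e.2 | e <- MH_matching s]].

(** The queue lists a final segment of the large items by decreasing index, so a large item of
    higher index than an entry precedes it. *)
Lemma mem_rev_half_large_index (i0 a : 'I_n) k : sorted_sizes s ->
  (k < size (rev (enum (half_large s))))%N ->
  (a < num_large s)%N -> (nth i0 (rev (enum (half_large s))) k < a)%N ->
  a \in take k (rev (enum (half_large s))).
Proof.
move=> hs; set q := rev _ => kq at1 ka.
have hq : nth i0 q k \in half_large s.
  by have := mem_nth i0 kq; rewrite /q mem_rev mem_enum.
have aq : a \in q.
  by rewrite mem_rev mem_enum; move: hq; rewrite !inE; lia.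
rewrite -(nth_index i0 aq); case: (ltnP (index a q) k) => ak.
  by rewrite -(nth_take i0 ak) mem_nth // size_takel ?(ltnW kq).
have tr : transitive (relpre (val : 'I_n -> nat) gtn).
  by move=> x y z h1 h2; exact: ltn_trans h2 h1.
have hsort : sorted (relpre val gtn) q by rewrite rev_sorted; exact: sorted_enum_ord.
move: ak; rewrite leq_eqVlt => /predU1P[e|ak].
  by move: ka; rewrite e nth_index // ltnn.
have := sorted_ltn_nth tr i0 hsort k (index a q).
rewrite !inE kq index_mem aq nth_index // => /(_ isT isT ak) /=.
by move: ka => /= h1 h2; have := ltn_trans h1 h2; rewrite ltnn.
Qed.

(** If the process on the items below [r] exhausts [half_large s], it matches half of the large
    items, and [Y] has at most one item per large item. Otherwise the partners under [pi] of the
    items in [q1] are smaller than the blocking large item, hence already used, and all items of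
    [q2] are matched. *)
Lemma MH_matching_count Y (pi : 'I_n -> 'I_n) r : sorted_sizes s ->
  Y \subset small s -> {in Y &, injective pi} ->
  (forall b, b \in Y -> (pi b < num_large s)%N /\ s (pi b) + s b <= 1) ->
  (#|[set b in Y | (b < r)%N]| <= 2 * #|[set j in MH_matched | (j < r)%N]|)%N.
Proof.
move=> hs YS inj hpi; set Yr := [set b in Y | _].
set qS := enum [set i in small s | (i < r)%N].
set qM := rev (enum (half_large s)).
have YrY b : b \in Yr -> b \in Y by rewrite inE => /andP[].
have hYr : (#|Yr| <= num_large s)%N.
  rewrite -(card_ord_lt num_large_le) -(card_in_imset (f := pi) (D := Yr)).
    apply: subset_leq_card; apply/subsetP => _ /imsetP[b /YrY/hpi[? _] ->].
    by rewrite inE.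
  by move=> x y /YrY ? /YrY ?; exact: inj.
have hg : (size (greedy_matching s qS qM) <=
    #|[set j in MH_matched | (j < r)%N]|)%N.
  have hu : uniq [seq e.2 | e <- greedy_matching s qS qM].
    by apply: subseq_uniq (greedy_snd _ _) _; exact: enum_uniq.
  rewrite -(size_map (fun e => e.2)) -(card_uniqP hu) -cardsE.
  apply: subset_leq_card; apply/subsetP => j; rewrite !inE => jg; apply/andP; split.
    by rewrite /MH_matching (enum_setID_lt (small s) r) greedy_cat map_cat mem_cat jg.
  have := mem_subseq (greedy_snd _ _) jg.
  by rewrite mem_enum inE => /andP[].
have hsort : sorted (fun i j => s j <= s i) qS.
  by apply: sub_sorted (sorted_enum_ord _) => i j /ltnW; have [_] := hs; apply.
apply: leq_trans (leq_mul (leqnn 2) hg).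
have [->|[q1 [q2 [eS hsz hq]]]] := greedy_blocking qM hsort.
  by rewrite size_rev -cardE card_half_large; lia.
set g := size (greedy_matching s q1 qM) in hsz hq.
have [gq|gq] := ltnP g (size qM); last first.
  have hz : size (greedy_matching s qS qM) = size qM.
    by apply/eqP; rewrite eqn_leq greedy_size hsz (leq_trans gq) // leq_addr.
  by rewrite hz size_rev -cardE card_half_large; lia.
have h1 : (#|Yr :&: [set i in q1]| <= g)%N.
  rewrite -(card_in_imset (f := pi)); last first.
    by move=> x y /setIP[/YrY ? _] /setIP[/YrY ? _]; exact: inj.
  apply: (@leq_trans #|take g qM|); last first.
    by apply: leq_trans (card_size _) _; rewrite size_takel // ltnW.
  apply: subset_leq_card; apply/subsetP => _ /imsetP[b /setIP[/YrY bY bq] ->].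
  have [hb1 hb2] := hpi _ bY; rewrite inE in bq.
  apply: (mem_rev_half_large_index (i0 := b)) => //.
  rewrite ltnNge; apply/negP => hle; have [_ mono] := hs.
  have := hq b _ bq; have := mono _ _ hle; move: hb2; rewrite -/qM; lra.
have h2 : (#|Yr :\: [set i in q1]| <= size q2)%N.
  apply: leq_trans (card_size q2); apply: subset_leq_card.
  apply/subsetP => b; rewrite inE => /andP[bq1 bY].
  have : b \in qS.
    rewrite mem_enum; move: bY; rewrite !inE => /andP[/(subsetP YS) + ->].
    by rewrite inE => ->.
  by rewrite eS mem_cat; move: bq1; rewrite inE => /negbTE->.
have := cardsID [set i in q1] Yr; rewrite hsz => <-.
by apply: leq_trans (leq_add h1 h2) _; rewrite mul2n -addnn leq_addr.
Qed.

Lemma sum_ord_ltS (F : 'I_n -> R) k (kn : (k < n)%N) :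
  \sum_(i < n | (i < k.+1)%N) F i = \sum_(i < n | (i < k)%N) F i + F (Ordinal kn).
Proof.
rewrite (bigD1 (Ordinal kn)) //= addrC; congr (_ + _).
apply: eq_bigl => i; rewrite -(inj_eq val_inj) /= ltnS.
by rewrite ltn_neqAle andbC.
Qed.

(** Abel summation: the prefix sums of [c] are non-negative and [v] is non-increasing. *)
Lemma sum_dominated X Y (v : 'I_n -> R) : (forall i, 0 <= v i) ->
  (forall i j : 'I_n, (i <= j)%N -> v j <= v i) ->
  (forall r, (#|[set i in Y | (i < r)%N]| <= 2 * #|[set i in X | (i < r)%N]|)%N) ->
  \sum_(i in Y) v i <= 2 * \sum_(i in X) v i.
Proof.
move=> v0 vmono hc.
pose c i : R := 2 * (i \in X)%:R - (i \in Y)%:R.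
have C0 r : 0 <= \sum_(i < n | (i < r)%N) c i.
  rewrite /c sumrB -mulr_sumr subr_ge0.
  have hcard Z : \sum_(i < n | (i < r)%N) (i \in Z)%:R =
      #|[set i in Z | (i < r)%N]|%:R :> R.
    rewrite -sumr_const [RHS]big_mkcond [LHS]big_mkcond; apply: eq_bigr => i _.
    by rewrite inE; case: (i \in Z); case: (i < r)%N.
  by rewrite !hcard -natrM ler_nat.
(* The induction needs an arbitrary lower bound [m] of [v] on the prefix; [m = 0] gives the
   claim. *)
have abel k m : (k <= n)%N -> (forall i : 'I_n, (i < k)%N -> m <= v i) -> 0 <= m ->
    m * \sum_(i < n | (i < k)%N) c i <= \sum_(i < n | (i < k)%N) c i * v i.
  elim: k m => [|k IH] m kn hm m0; first by rewrite !big_pred0 ?mulr0.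
  have := C0 k.+1; rewrite !(sum_ord_ltS _ kn) => hC.
  have : v (Ordinal kn) * \sum_(i < n | (i < k)%N) c i <=
      \sum_(i < n | (i < k)%N) c i * v i.
    by apply: IH => //; [exact: ltnW | move=> i ik; apply: vmono; exact: ltnW].
  by have := hm (Ordinal kn) (leqnn _); nra.
have := abel n 0 (leqnn _) (fun i _ => v0 i) (lexx _); rewrite mul0r.
have -> : \sum_(i < n | (i < n)%N) c i * v i =
    2 * \sum_(i in X) v i - \sum_(i in Y) v i.
  rewrite mulr_sumr !(big_mkcond (fun i => i \in _)) -sumrB.
  apply: eq_big => [i|i _]; first by rewrite ltn_ord.
  by rewrite /c; case: (i \in X); case: (i \in Y) => /=; ring.
by rewrite subr_ge0.
Qed.

End Matching.

(** * MatchHalf against a packing *)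

Section MatchHalf.
Variables (R : realType) (n : nat) (s : 'I_n -> R).
Implicit Types (B X V : {set 'I_n}) (P : {set {set 'I_n}}).

(** [MH s] is a set, in which equal bins of the list merge; an upper bound on its cost is enough. *)
Lemma sum_set_seq_le (F : {set 'I_n} -> nat) (l : seq {set 'I_n}) :
  (\sum_(B in [set B in l]) F B <= \sum_(B <- l) F B)%N.
Proof.
elim: l => [|A l IH]; first by rewrite set_nil big_set0.
rewrite big_cons; have [Al|Al] := boolP (A \in l).
  have -> : [set B in A :: l] = [set B in l].
    by apply/setP => B; rewrite !inE; case: eqP => // ->; rewrite Al.
  exact: leq_trans IH (leq_addl _ _).
have -> : [set B in A :: l] = A |: [set B in l] by apply/setP => B; rewrite !inE.
by rewrite big_setU1 ?inE //= leq_add2l.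
Qed.

Lemma bigcup_pairs (l : seq ('I_n * 'I_n)) :
  \bigcup_(B <- [seq [set e.1; e.2] | e <- l]) B =
  [set i in [seq e.1 | e <- l]] :|: [set i in [seq e.2 | e <- l]].
Proof.
elim: l => [|e l IH]; first by rewrite big_nil !set_nil setU0.
rewrite /= big_cons IH; apply/setP => i; rewrite !inE.
by case: (i == e.1); case: (i == e.2); case: (i \in _).
Qed.

Lemma in_small i : (i \in small s) = (num_large s <= i)%N.
Proof. by rewrite inE ltnS. Qed.

Lemma MH_matched_small : MH_matched s \subset small s.
Proof.
apply/subsetP => j; rewrite inE => /(mem_subseq (greedy_snd _ _ _)).
by rewrite mem_enum.
Qed.

Lemma size_MH_matching : (size (MH_matching s) <= uphalf (num_large s))%N.
Proof.
apply: leq_trans (greedy_size _ _ _) _.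
by rewrite size_rev -cardE card_half_large.
Qed.

(** NFI meets the unmatched large items after all small ones, and each of them adds at most 1. *)
Lemma MH_cost_le q :
  (\sum_(B in MH s) minn #|B| q <=
   size (MH_matching s) * minn 2 q +
   \sum_(C <- NFI s (small s :\: MH_matched s)) minn #|C| q +
   (num_large s - size (MH_matching s)))%N.
Proof.
apply: leq_trans (sum_set_seq_le _ _) _; rewrite big_cat /= -addnA.
apply: leq_add.
  rewrite /MH_pairs big_map; elim: (MH_matching s) => [|e l IH].
    by rewrite big_nil.
  rewrite big_cons mulSn; apply: leq_add => //.
  have : (#|[set e.1; e.2]| <= 2)%N by rewrite cards2; case: (_ != _).
  by move=> h; rewrite leq_min geq_minr andbT (leq_trans (geq_minl _ _) h).
set M1 := [set i in [seq e.1 | e <- MH_matching s]].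
set A := ~: _.
have hA : A = ~: (M1 :|: MH_matched s) by rewrite /A bigcup_pairs.
have hM1 i : i \in M1 -> (i < num_large s)%N.
  rewrite inE greedy_fst => /mem_take; rewrite mem_rev mem_enum inE.
  by case/andP.
rewrite {1}/NFI (enum_setID_lt A (num_large s)) rev_cat.
apply: leq_trans (next_fit_cost_cat s q _ _) _.
have -> : [set i in A | (num_large s <= i)%N] = small s :\: MH_matched s.
  apply/setP => i; rewrite in_set hA in_setC in_setU negb_or in_setD in_small.
  case: leqP => hi; rewrite ?andbF ?andbT //.
  suff -> : i \notin M1 by [].
  by apply: contraL hi => /hM1; rewrite -ltnNge.
have inL (i : 'I_n) : (i \in [set i : 'I_n | (i < num_large s)%N]) = (i < num_large s)%N.
  by rewrite inE.
apply: leq_add => //; rewrite size_rev -cardE.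
have -> : [set i in A | (i < num_large s)%N] = [set i : 'I_n | (i < num_large s)%N] :\: M1.
  apply/setP => i; rewrite in_set hA in_setC in_setU negb_or in_setD inL.
  case: ltnP => hi; rewrite ?andbF ?andbT //.
  suff -> : i \notin MH_matched s by rewrite andbT.
  by apply: contraL hi => /(subsetP MH_matched_small); rewrite in_small -leqNgt.
rewrite cardsD card_ord_lt ?num_large_le //.
have -> : [set i : 'I_n | (i < num_large s)%N] :&: M1 = M1.
  by apply/setIidPr/subsetP => i /hM1; rewrite inE.
have -> : #|M1| = size (MH_matching s); last by [].
rewrite cardsE -[RHS](size_map (fun e => e.1)); apply/card_uniqP.
by rewrite greedy_fst take_uniq // rev_uniq enum_uniq.
Qed.

Hypothesis hs : sorted_sizes s.
Variable P : {set {set 'I_n}}.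
Hypothesis hP : packing s P.

Definition has_large B : bool := [exists i in B, (i < num_large s)%N].

Let s_ge0 i : 0 <= s i.
Proof. by have [/(_ i)/andP[]] := hs. Qed.

Let partP : finset.partition P [set: 'I_n].
Proof. by case/andP: hP. Qed.

Let fitP B : B \in P -> \sum_(i in B) s i <= 1.
Proof. by case/andP: hP => _ /forallP/(_ B)/implyP. Qed.

Lemma small_size i : i \in small s -> s i <= 1 / 2.
Proof. by rewrite in_small leqNgt lt_num_large // -leNgt; lra. Qed.

Lemma large_rest B V a : B \in P -> V \subset small s -> a \in B ->
  (a < num_large s)%N ->
  \sum_(i in V :&: B) s i <= 1 / 2 /\ (#|V :&: B| < #|B|)%N.
Proof.
move=> BP VS aB al.
have sub : V :&: B \subset B :\ a.
  apply/subsetP => i; rewrite !inE => /andP[/(subsetP VS) iS ->]; rewrite andbT.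
  by apply: contraL iS => /eqP->; rewrite in_small -ltnNge.
split; last first.
  by rewrite (cardsD1 a B) aB ltnS; apply: subset_leq_card.
have := fitP BP; rewrite (big_setD1 a) //=.
have := sum_subset_le s_ge0 sub.
by move: al; rewrite lt_num_large //; lra.
Qed.

(** Two large items never fit in one bin of [P]. *)
Lemma num_large_le_blocks : (num_large s <= \sum_(B in P) has_large B)%N.
Proof.
set L := [set i : 'I_n | (i < num_large s)%N].
have hL : (#|L| = num_large s)%N by rewrite card_ord_lt // num_large_le.
rewrite -hL -sum1_card.
have -> : (\sum_(i in L) 1 = \sum_(B in P) #|L :&: B|)%N.
  transitivity (\sum_(i in [set: 'I_n] | i \in L) 1)%N.
    by apply: eq_bigl => i; rewrite !inE.
  rewrite (set_partition_big_cond _ partP); apply: eq_bigr => B _.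
  by rewrite -sum1_card; apply: eq_bigl => i; rewrite in_setI andbC.
apply: leq_sum => B BP.
have [-> |[a /setIP[aL aB]]] := set_0Vmem (L :&: B); first by rewrite cards0.
have -> : has_large B by apply/existsP; exists a; rewrite aB; move: aL; rewrite inE.
rewrite leqNgt; apply/negP; rewrite (cardsD1 a) !inE aB andbT.
move: (aL); rewrite inE => al; rewrite al add1n ltnS => /card_gt0P[b].
rewrite !inE => /and3P[ba bl bB].
have := fitP BP; rewrite (big_setD1 a) //= (big_setD1 b) /=; last by rewrite !inE ba.
have : 0 <= \sum_(i in B :\ a :\ b) s i by apply: sumr_ge0.
by move: al bl; rewrite !lt_num_large //; lra.
Qed.

Lemma MH_capped_cost_ge2 q : (1 < q)%N ->
  (\sum_(B in MH s) minn #|B| q)%:R <=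
  3 / 2 * (\sum_(B in P) minn #|B| q)%:R + 3 :> R.
Proof.
move=> q2; set V := small s :\: MH_matched s.
have VS : V \subset small s by exact: subsetDl.
have := @NFI_cost_le R n s q P V has_large hs q2 partP.
set nf := (\sum_(C <- _) _)%N.
have hfit B : B \in P -> \sum_(i in V :&: B) s i <= 1 - (has_large B)%:R / 2.
  move=> BP; case: (boolP (has_large B)) => [/existsP[a /andP[aB al]]|_] /=.
    by have [] := large_rest BP VS aB al; lra.
  have := sum_subset_le s_ge0 (subsetIr V B); have := fitP BP; lra.
move=> /(_ hfit).
set val := (\sum_(B in P) minn _ (_ - _))%N => hnf.
(* A large item of [B] lies outside [V], so it can be added to [minn #|V :&: B| (q - 1)] within
   [minn #|B| q]. *)
have hval : (val + num_large s <= \sum_(B in P) minn #|B| q)%N.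
  apply: leq_trans (leq_add (leqnn _) num_large_le_blocks) _.
  rewrite /val -big_split /=; apply: leq_sum => B BP.
  have hc : (#|V :&: B| <= #|B|)%N by apply: subset_leq_card; exact: subsetIr.
  case: (boolP (has_large B)) => [/existsP[a /andP[aB al]]|_] /=; last first.
    by rewrite subn0 addn0 leq_min geq_minr andbT (leq_trans (geq_minl _ _)).
  have [_ hlt] := large_rest BP VS aB al.
  by move: hlt q2; move: #|_| #|_| => x y; lia.
have hm := size_MH_matching; have hcost := MH_cost_le q.
rewrite -/V -/nf in hcost.
(* With [t] large items and [m] pairs the cost is at most [t + m + nf], where [2 * m <= t + 1]. *)
have {hcost}h : (2 * \sum_(B in MH s) minn #|B| q <= 3 * num_large s + 1 + 2 * nf)%N.
  by move: hcost hm; rewrite (minn_idPl q2); lia.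
rewrite -(ler_nat R) natrM 2!natrD 2!natrM in h; rewrite -(ler_nat R) natrD in hval.
lra.
Qed.

(** The least index gives a largest small item of the bin and makes it unique. *)
Definition first_small : {set 'I_n} :=
  [set b in small s | has_large (pblock P b) &&
    [forall j in small s :&: pblock P b, (b <= j)%N]].

Let trivP : trivIset P.
Proof. by case/and3P: partP. Qed.

Let pblockP i : pblock P i \in P /\ i \in pblock P i.
Proof.
have ic : i \in cover P by case/and3P: partP => /eqP-> _ _; rewrite inE.
by split; [exact: pblock_mem | rewrite mem_pblock].
Qed.

(** The default [b] does not occur for [b] in [first_small]. *)
Definition block_large b : 'I_n :=
  odflt b [pick a in pblock P b | (a < num_large s)%N].

Lemma block_largeP b : b \in first_small ->
  block_large b \in pblock P b /\ (block_large b < num_large s)%N.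
Proof.
rewrite inE => /and3P[_ /existsP[a /andP[ab al]] _]; rewrite /block_large.
by case: pickP => [c /andP[]//|/(_ a)]; rewrite ab al.
Qed.

(** Each item of [first_small] fits with the large item of its own bin, and different items lie in
    different bins, so the prefix counts of the matching apply. *)
Lemma first_small_le_matched :
  \sum_(i in first_small) half_weight (s i) <=
  2 * \sum_(i in MH_matched s) half_weight (s i).
Proof.
(* The value [1 / 2] on large items makes [v] non-increasing on all indices. *)
pose v i := if i \in small s then half_weight (s i) else 1 / 2.
have vE X : X \subset small s -> \sum_(i in X) half_weight (s i) = \sum_(i in X) v i.
  by move=> XS; apply: eq_bigr => i /(subsetP XS) iS; rewrite /v iS.
have YS : first_small \subset small s by apply/subsetP => i; rewrite inE => /andP[].
rewrite !vE ?MH_matched_small //.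
have s1 i : 0 <= s i <= 1 by have [/(_ i)] := hs.
apply: sum_dominated.
- by move=> i; rewrite /v; case: ifP => _; [exact: half_weight_ge0 | lra].
- move=> i j ij; rewrite /v; case: ifP => jS; last first.
    by rewrite ifF //; move: jS; rewrite !inE; lia.
  case: ifP => [/small_size iS|_]; last exact: half_weight_le_half.
  by apply: half_weight_mono; [exact: s_ge0 | have [_] := hs; apply | lra].
move=> r; apply: (MH_matching_count (pi := block_large)) => //.
  move=> x y xY yY e; have [xb _] := block_largeP xY; have [yb _] := block_largeP yY.
  have [xP xx] := pblockP x; have [yP yy] := pblockP y.
  have eb : pblock P x = pblock P y.
    by rewrite -(def_pblock trivP xP xb) e (def_pblock trivP yP yb).
  apply: val_inj; apply/eqP; rewrite eqn_leq.
  move: xY yY; rewrite !inE => /and3P[xS _ /forallP hx] /and3P[yS _ /forallP hy].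
  have := hx y; have := hy x; rewrite !inE xS yS eb yy -{1}eb xx /=.
  by move=> -> ->.
move=> b bY; have [ab al] := block_largeP bY; split => //.
have [bP bb] := pblockP b; have := fitP bP; rewrite (big_setD1 (block_large b)) //=.
have hb : b \in pblock P b :\ block_large b.
  rewrite !inE bb andbT; apply: contraTneq al => <-.
  by move: (subsetP YS _ bY); rewrite in_small -leqNgt.
rewrite (big_setD1 b) //=.
have : 0 <= \sum_(i in pblock P b :\ block_large b :\ b) s i by apply: sumr_ge0.
lra.
Qed.

Lemma block_half_weight B : B \in P ->
  \sum_(i in small s :&: B) half_weight (s i) + (has_large B)%:R <=
  3 / 2 + 1 / 2 * \sum_(i in first_small :&: B) half_weight (s i).
Proof.
move=> BP; have s1 i : 0 <= s i <= 1 by have [/(_ i)] := hs.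
have w0 i : 0 <= half_weight (s i) by exact: half_weight_ge0.
have Y0 : 0 <= \sum_(i in first_small :&: B) half_weight (s i) by apply: sumr_ge0.
case: (boolP (has_large B)) => [hB|_] /=; last first.
  have : \sum_(i in small s :&: B) half_weight (s i) <=
      \sum_(i in small s :&: B) 3 / 2 * s i.
    apply: ler_sum => i /setIP[/small_size h _]; apply: half_weight_le.
    by rewrite s_ge0 /=; lra.
  rewrite -mulr_sumr; have := sum_subset_le s_ge0 (subsetIr (small s) B).
  by have := fitP BP; lra.
have [a /andP[aB al]] := existsP hB.
have [-> |[b0 b0S]] := set_0Vmem (small s :&: B); first by rewrite big_set0; lra.
have [b bS bmin] := arg_minnP (fun i : 'I_n => val i) b0S.
have [bs bB] := setIP bS.
have bY : b \in first_small :&: B.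
  rewrite !inE bB andbT (def_pblock trivP BP bB) hB; move: bs; rewrite inE => -> /=.
  by apply/forallP => j; apply/implyP => /bmin.
have [hfit _] := large_rest BP (subxx _) aB al.
have : \sum_(i in small s :&: B) half_weight (s i) <= 1 / 2 + half_weight (s b) / 2.
  apply: half_weight_bin => // i /bmin ib; rewrite s_ge0 /=.
  by have [_] := hs; apply.
have : half_weight (s b) <= \sum_(i in first_small :&: B) half_weight (s i).
  by rewrite (big_setD1 b) //= lerDl; apply: sumr_ge0.
lra.
Qed.

Lemma MH_capped_cost1 :
  (\sum_(B in MH s) minn #|B| 1)%:R <=
  3 / 2 * (\sum_(B in P) minn #|B| 1)%:R + 3 :> R.
Proof.
set V := small s :\: MH_matched s.
have hV : (size (NFI s V))%:R <= \sum_(i in V) half_weight (s i) + 11 / 4.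
  by apply: NFI_card_le => // i; rewrite inE => /andP[_ /small_size].
have hcost : (\sum_(B in MH s) minn #|B| 1 <= num_large s + size (NFI s V))%N.
  apply: leq_trans (MH_cost_le 1) _; rewrite -/V.
  have : (\sum_(C <- NFI s V) minn #|C| 1 <= size (NFI s V))%N.
    by rewrite -sum1_size; apply: leq_sum => C _; exact: geq_minr.
  by have := size_MH_matching; lia.
have hblocks : (\sum_(B in P) minn #|B| 1)%N = #|P|.
  rewrite -sum1_card; apply: eq_bigr => B BP; apply/minn_idPr.
  by rewrite card_gt0; apply: contraTneq BP => ->; case/and3P: partP.
have hsum : \sum_(i in small s) half_weight (s i) + (num_large s)%:R <=
    3 / 2 * #|P|%:R + 1 / 2 * \sum_(i in first_small) half_weight (s i).
  rewrite !(sum_partition _ _ partP).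
  apply: (@le_trans _ _ (\sum_(B in P)
    (\sum_(i in small s :&: B) half_weight (s i) + (has_large B)%:R))).
    by rewrite big_split /= lerD2l -natr_sum ler_nat num_large_le_blocks.
  apply: (@le_trans _ _ (\sum_(B in P)
    (3 / 2 + 1 / 2 * \sum_(i in first_small :&: B) half_weight (s i)))).
    by apply: ler_sum => B; exact: block_half_weight.
  by rewrite big_split /= sumr_const -mulr_sumr -[X in X + _ <= _]mulr_natr.
(* The matched items, absent from [V], weigh at least half as much as [first_small]; this cancels
   the last term of [hsum]. *)
have := first_small_le_matched; move: hV hsum hcost.
rewrite (sum_setID _ (MH_matched s) (small s)) (setIidPr MH_matched_small) -/V hblocks.
rewrite -(ler_nat R) natrD; lra.
Qed.

End MatchHalf.

(** * Concave costs as combinations of capped costs *)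

Section Cost.
Variables (R : realType) (n : nat) (f : nat -> R).
Hypothesis hf : cost_function n f.

(** Slope 0 from [n] on makes the sums of [cap_coef] telescope to a single slope. *)
Definition cost_slope q : R := if (q < n)%N then f q.+1 - f q else 0.

Definition cap_coef q : R := cost_slope q - cost_slope q.+1.

Lemma cap_coef_ge0 q : 0 <= cap_coef q.
Proof.
have [_ _ _ mono conc] := hf.
rewrite /cap_coef /cost_slope; case: ltnP => h1; last by rewrite ltnNge (leqW h1) subr0.
case: ltnP => h2; first by rewrite subr_ge0; exact: conc.
by rewrite subr0 subr_ge0; apply: mono; rewrite leqnSn.
Qed.

Lemma sum_cap_coef k : (k <= n)%N -> \sum_(k <= q < n) cap_coef q = cost_slope k.
Proof.
move=> kn; have := telescope_sumr cost_slope kn.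
have sn : cost_slope n = 0 by rewrite /cost_slope ltnn.
rewrite sn sub0r => h.
by rewrite -[RHS]opprK -h -sumrN; apply: eq_bigr => q _; rewrite opprB.
Qed.

(** Passing from [k] to [k + 1] raises [minn k q.+1] by one exactly for [q >= k], and these
    coefficients add up to the slope at [k]. *)
Lemma cost_capE k : (k <= n)%N ->
  f k = \sum_(0 <= q < n) cap_coef q * (minn k q.+1)%:R.
Proof.
have [f0 _ _ _ _] := hf; elim: k => [|k IH] kn.
  by rewrite f0 big1 // => q _; rewrite min0n mulr0.
have -> : f k.+1 = f k + cost_slope k by rewrite /cost_slope kn addrC subrK.
rewrite IH 1?ltnW // -sum_cap_coef 1?ltnW //.
rewrite !(big_cat_nat (leq0n k) (ltnW kn)) /= -addrA -big_split /=.
congr (_ + _); apply: eq_big_nat => q /andP[h1 h2].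
  by rewrite (minn_idPr h2) (minn_idPr (leqW h2)).
by rewrite (minn_idPl (leqW h1)) (minn_idPl _) // -natr1 mulrDr mulr1.
Qed.

Lemma cost_partE (Q : {set {set 'I_n}}) :
  cost f Q = \sum_(0 <= q < n) cap_coef q * (\sum_(B in Q) minn #|B| q.+1)%:R.
Proof.
rewrite /cost (eq_bigr (fun B : {set 'I_n} =>
    \sum_(0 <= q < n) cap_coef q * (minn #|B| q.+1)%:R)).
  rewrite exchange_big; apply: eq_bigr => q _.
  by rewrite natr_sum mulr_sumr.
by move=> B _; apply: cost_capE; rewrite -[leqRHS]card_ord max_card.
Qed.

Lemma MH_cost_le_packing (s : 'I_n -> R) (P : {set {set 'I_n}}) :
  sorted_sizes s -> packing s P -> cost f (MH s) <= 3 / 2 * cost f P + 3.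
Proof.
move=> hs hP; rewrite !cost_partE.
apply: (@le_trans _ _ (\sum_(0 <= q < n) (cap_coef q *
    (3 / 2 * (\sum_(B in P) minn #|B| q.+1)%:R + 3)))).
  apply: ler_sum => q _; rewrite ler_wpM2l ?cap_coef_ge0 //.
  by case: q => [|q]; [exact: MH_capped_cost1 | exact: MH_capped_cost_ge2].
under eq_bigr do rewrite mulrDr mulrCA.
(* The coefficients add up to [f 1 - f 0 = 1], or to 0 if [n = 0], so the additive constants
   contribute at most 3. *)
rewrite big_split /= -mulr_sumr lerD2l -mulr_suml sum_cap_coef //.
rewrite /cost_slope; case: ltnP => [n0|_]; last by rewrite mul0r.
by have [-> -> // _ _ _] := hf; rewrite subr0 mul1r.
Qed.

Lemma packing_singletons (s : 'I_n -> R) : (forall i, s i <= 1) ->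
  packing s [set [set i] | i : 'I_n].
Proof.
move=> s1; apply/andP; split; last first.
  by apply/forallP => B; apply/implyP => /imsetP[i _ ->]; rewrite big_set1.
apply/and3P; split.
- apply/eqP/setP => i; rewrite inE; apply/bigcupP; exists [set i]; last exact: set11.
  exact: imset_f.
- apply/trivIsetP => _ _ /imsetP[i _ ->] /imsetP[j _ ->] ij.
  by rewrite disjoints1 inE; apply: contra ij => /eqP->.
- by apply/imsetP => -[i _ /setP/(_ i)]; rewrite !inE eqxx.
Qed.

Lemma MH_cost_le_OPT (s : 'I_n -> R) : sorted_sizes s ->
  cost f (MH s) <= 3 / 2 * OPT f s + 3.
Proof.
move=> hs; rewrite /OPT; elim/big_ind: _ => [|x y hx hy|P hP].
- apply: MH_cost_le_packing => //; apply: packing_singletons => i.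
  by have [/(_ i)/andP[]] := hs.
- by rewrite /Num.min; case: ifP.
- exact: MH_cost_le_packing.
Qed.

End Cost.

Theorem theorem2 (R : realType) (f : nat -> nat -> R)
    (f_cost : forall n : nat, cost_function n (f n)) :
  (asymptotic_ratio (@MH R) f <= (3 / 2)%:E)%E.
Proof.
apply: ereal_inf_lbound; exists (3 / 2) => //; split; first lra.
by exists 3 => n s hs; exact: MH_cost_le_OPT.
Qed.
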